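(* Let $\lambda>-1/2$, $\eta\in\mathbb R$, $b=\lambda+\mathrm i\eta$, and $\nu(z)=(-z)^{-\overline b}(1-z)^{b+\overline b}$ on $\mathbb T$. Then for every $n\in\mathbb N$ the following hypergeometric differential equations hold (those for $G_n,G_{n-1}^*$ being for $z\notin\mathbb T$): $$z(1-z)\Phi_n''(z)+\big((n-b-2)z+(1-n-\overline b)\big)\Phi_n'(z)+n(1+b)\Phi_n(z)=0,$$ $$z(1-z)G_n''(z)+\big((b-n-2)z+(1+n+\overline b)\big)G_n'(z)+b(1+n)G_n(z)=0,$$ $$z(1-z)(\Phi_{n-1}^* )''(z)+\big((n-b-2)z+(1-n-\overline b)\big)(\Phi_{n-1}^* )'(z)+b(n-1)\Phi_{n-1}^*(z)=0,$$ $$z(1-z)(G_{n-1}^* )''(z)+\big((b-n-2)z+(1+n+\overline b)\big)(G_{n-1}^* )'(z)+n(b-1)G_{n-1}^*(z)=0.$$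
   Context: $\mathbb N=\{1,2,\dots\}$, $\mathbb T=\{|z|=1\}$ (counterclockwise), $d\mu(z)=\frac{\nu(z)}{\mathrm i z}dz$. Powers are principal branches, so $\nu(e^{\mathrm i\theta})=e^{-\eta(\theta-\pi)}(4\sin^2(\theta/2))^{\lambda}$ for $0<\theta<2\pi$. $\Phi_n$ is the monic polynomial of degree $n$ with $\int_{\mathbb T}\Phi_n\overline{\Phi_m}\,d\mu=\kappa_n^{-2}\delta_{n,m}$, $\kappa_n>0$; $\Phi_n^*(z)=z^n\overline{\Phi_n(1/\bar z)}$. For $z\notin\mathbb T$, $$G_n(z)=\frac1{2\pi \mathrm i}\int_{\mathbb T}\frac{\Phi_n(t)}{t-z}\frac{\nu(t)}{t^n}dt,\qquad G_{n-1}^*(z)=\frac1{2\pi \mathrm i}\int_{\mathbb T}\frac{\Phi_{n-1}^*(t)}{t-z}\frac{\nu(t)}{t^n}dt .$$ *)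

(* Defs.v *)
From mathcomp Require Import all_boot all_order all_algebra.
From mathcomp Require Import all_classical all_reals all_analysis.
From mathcomp Require Import complex.
From mathcomp Require Import ring lra.

Set Implicit Arguments.
Unset Strict Implicit.
Unset Printing Implicit Defensive.

Import Order.TTheory GRing.Theory Num.Theory.
Import numFieldNormedType.Exports.

Local Open Scope classical_set_scope.
Local Open Scope complex_scope.
Local Open Scope ring_scope.

Local Notation Re := complex.Re.
Local Notation Im := complex.Im.

(* The complex numbers are R[i] for R : realType.  ring_scope being opened    *)
(* last, z^* and 'i are the generic Num.conj and Num.imaginary, convertible   *)
(* to the concrete operations on R[i].  The norm `|z| is R[i]-valued.         *)

Section Principal.
Variable R : realType.
Implicit Types z w : R[i].

Definition cexp z : R[i] := (expR (Re z))%:C * (cos (Im z) +i* sin (Im z)).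

(* Principal argument, in ]-pi, pi] for z != 0 (no meaning at 0). *)
Definition carg z : R :=
  let t := acos (Re z / Re `|z|) in if 0 <= Im z then t else - t.

Definition clog z : R[i] := ln (Re `|z|) +i* carg z.

Definition cpow z w : R[i] := cexp (w * clog z).

End Principal.

Section Circle.
Variable R : realType.

Definition expi (theta : R) : R[i] := cos theta +i* sin theta.

(* Integral over the counterclockwise unit circle, as a Lebesgue integral in  *)
(* the angle taken separately on real and imaginary parts.  Leaving out the   *)
(* null set {1} avoids the point where the weight below may be singular.      *)
Definition circle_integral (f : R[i] -> R[i]) : R[i] :=
  let g (theta : R) := f (expi theta) * ('i * expi theta) in
  (\int[lebesgue_measure]_(theta in `]0, 2 * pi[) Re (g theta)) +i*
  (\int[lebesgue_measure]_(theta in `]0, 2 * pi[) Im (g theta)).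

Definition circle_weight (b z : R[i]) : R[i] :=
  cpow (- z) (- b^*) * cpow (1 - z) (b + b^*).

(* (Phi, kappa) is the system of monic orthogonal polynomials, with its       *)
(* norming constants, for dmu(z) = nu(z) / (i z) dz on the unit circle.       *)
Definition monic_opuc (nu : R[i] -> R[i]) (Phi : nat -> {poly R[i]})
    (kappa : nat -> R) : Prop :=
  forall n : nat,
    [/\ Phi n \is monic, size (Phi n) = n.+1, 0 < kappa n
      & forall m : nat,
          circle_integral
            (fun z => (Phi n).[z] * ((Phi m).[z])^* * (nu z / ('i * z)))
          = ((kappa n ^- 2) *+ (n == m))%:C].

(* The reversed polynomial z^n conj(p(1 / conj z)), see conj_revE. *)
Definition conj_rev (n : nat) (p : {poly R[i]}) : {poly R[i]} :=
  \poly_(i < n.+1) (p`_(n - i))^*.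

(* With p := Phi_n this is G_n; with p := Phi_(n-1)^* it is G_(n-1)^*: both   *)
(* carry the factor t^n in the denominator.                                   *)
Definition cauchy_weighted (nu : R[i] -> R[i]) (n : nat) (p : {poly R[i]})
    (z : R[i]) : R[i] :=
  (2 * pi%:C * 'i)^-1 *
  circle_integral (fun t => p.[t] / (t - z) * (nu t / t ^+ n)).

End Circle.

(* Complex differentiation: R[i]^o is R[i] as a normed module over itself. *)
Definition cderivable (R : realType) (f : R[i] -> R[i]) (z : R[i]) : Prop :=
  derivable (f : R[i]^o -> R[i]^o) z 1.

Definition cderive (R : realType) (f : R[i] -> R[i]) : R[i] -> R[i] :=
  derive1 (f : R[i] -> R[i]^o).

Lemma conj_revE (R : realType) (n : nat) (p : {poly R[i]}) (z : R[i]) :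
  (size p <= n.+1)%N -> z != 0 ->
  (conj_rev n p).[z] = z ^+ n * (p.[(z^*)^-1])^*.
Proof.
move=> sp z0; rewrite /conj_rev horner_poly (horner_coef_wide _ sp).
rewrite (rmorph_sum (@conjc R)) mulr_sumr (reindex_inj rev_ord_inj) /=.
apply: eq_bigr => i _; rewrite subSS.
have ilen : (i <= n)%N by rewrite -ltnS.
rewrite subKn // rmorphM rmorphXn /= conjc_inv conjcK mulrCA exprVn.
by rewrite expfB_cond ?(negbTE z0) // add0n.
Qed.

Lemma clog_polar (R : realType) (r a : R) :
  0 < r -> - pi < a <= pi -> clog (r%:C * expi a) = ln r +i* a.
Proof.
move=> r0 /andP[ha1 ha2].
have nE : Re `|r%:C * expi a| = r.
  rewrite normc_def /= !mul0r subr0 addr0 !exprMn -mulrDr cos2Dsin2 mulr1.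
  by rewrite sqrtr_sqr gtr0_norm.
rewrite /clog /carg nE /= !mul0r subr0 addr0 mulrAC mulfV ?gt_eqF // mul1r.
congr (_ +i* _); rewrite pmulr_rge0 //.
case: (leP 0 a) => a0.
  by rewrite sin_ge0_pi ?a0 ?ha2 // cosK // in_itv /= a0 ha2.
have sa : sin a < 0.
  rewrite -oppr_gt0 -sinN sin_gt0_pi // oppr_gt0 a0 /=.
  by rewrite ltrNl.
by rewrite leNgt sa /= -cosN cosK ?opprK // in_itv /= oppr_ge0 ltW //= lerNl ltW.
Qed.

Lemma circle_weightE (R : realType) (lambda eta theta : R) :
  0 < theta < 2 * pi ->
  circle_weight (lambda +i* eta) (expi theta) =
  (expR (- eta * (theta - pi)) * (4 * sin (theta / 2) ^+ 2) `^ lambda)%:C.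
Proof.
move=> /andP[t0 t2]; have pi0 := pi_gt0 R.
have tE : theta = (theta / 2) *+ 2 by rewrite -mulr_natr divfK // pnatr_eq0.
have s0 : 0 < sin (theta / 2).
  by apply: sin_gt0_pi; rewrite divr_gt0 //= ltr_pdivrMr // mulrC.
have r0 : 0 < 2 * sin (theta / 2) by rewrite mulr_gt0.
have Nz : - expi theta = 1%:C * expi (theta - pi).
  rewrite mul1r /expi cosB sinB cospi sinpi !mulr0 !mulrN1 addr0 subr0.
  by [].
have Bz : 1 - expi theta =
    (2 * sin (theta / 2))%:C * expi ((theta - pi) / 2).
  rewrite /expi mulrBl cosB sinB cos_pihalf sin_pihalf !mulr0 !mulr1.
  rewrite add0r sub0r {1 2}tE cos_mulr2n sin_mulr2n cos2sin2.
  apply/eqP; rewrite eq_complex /=; apply/andP; split; apply/eqP; ring.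
have a1 : - pi < theta - pi <= pi by apply/andP; split; lra.
have a2 : - pi < (theta - pi) / 2 <= pi by apply/andP; split; lra.
rewrite /circle_weight Bz Nz /cpow (clog_polar ltr01 a1) (clog_polar r0 a2).
have -> : - (lambda +i* eta)^* * (ln 1 +i* (theta - pi)) =
    (- eta * (theta - pi)) +i* (- (lambda * (theta - pi))).
  by rewrite ln1; apply/eqP; rewrite eq_complex /=; apply/andP; split;
    apply/eqP; ring.
have -> : (lambda +i* eta + (lambda +i* eta)^*) *
      (ln (2 * sin (theta / 2)) +i* ((theta - pi) / 2)) =
    (lambda * (2 * ln (2 * sin (theta / 2)))) +i* (lambda * (theta - pi)).
  by apply/eqP; rewrite eq_complex /=; apply/andP; split; apply/eqP; field.
have -> : 4 * sin (theta / 2) ^+ 2 = (2 * sin (theta / 2)) ^+ 2 by ring.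
rewrite /powR gt_eqF ?exprn_gt0 // lnXn // -(mulr_natl (ln _)) /cexp /= cosN sinN.
set x := lambda * (theta - pi); have cs := cos2Dsin2 x.
apply/eqP; rewrite eq_complex /=; apply/andP; split; apply/eqP; last by ring.
set A := expR _; set B := expR _.
by transitivity (A * B * (cos x ^+ 2 + sin x ^+ 2)); [ring | rewrite cs mulr1].
Qed.

(* Main.v *)
Require Import Defs.
From mathcomp Require Import all_boot all_order all_algebra.
From mathcomp Require Import all_classical all_reals all_analysis.
From mathcomp Require Import complex.
From mathcomp Require Import measurable_realfun ring lra.

Set Implicit Arguments.
Unset Strict Implicit.
Unset Printing Implicit Defensive.

Import Order.TTheory GRing.Theory Num.Theory.
Import numFieldNormedType.Exports.

Local Open Scope classical_set_scope.
Local Open Scope complex_scope.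
Local Open Scope ring_scope.

Local Notation Re := complex.Re.
Local Notation Im := complex.Im.

(* On the circle the weight satisfies the Pearson equation
   [(z - 1) z nu' = (b z + conj b) nu], so integrating the derivative of
   [(z - 1) g nu] gives a linear relation between integrals against [nu] for every
   smooth [g]; the boundary terms at [z = 1] vanish because [lambda > -1/2], and
   [nu] is integrable because its total mass is [kappa_0 ^- 2 <> 0].  Taking
   [g = z^-m p] with [p = z Phi_n'] and [p = Phi_n] shows that the hypergeometric
   operator sends [Phi_n] to a polynomial of degree [< n] orthogonal to
   [1, .., z^(n-1)], i.e. to [0]; reversing the resulting two-term recurrence of the
   coefficients gives the equation for [Phi_(n-1)^*].  Taking
   [g = t^(1-n) (p' r + p r^2)] with [r = 1 / (t - z)] turns the equation of a
   polynomial [p] into the one of its Cauchy transform. *)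

(** * Fundamental theorem of calculus with singular endpoints *)

(** The integrand may blow up at [a] and [b], so only integrability on the open interval is asked.
    Extended by zero, it has a primitive [H] continuous up to the endpoints; [H - F] has zero
    derivative inside, and the mean value theorem equates its two end values. *)
Lemma Rintegral_derivative_oo (R : realType) (f F : R -> R) (a b : R) :
  a < b ->
  lebesgue_measure.-integrable `]a, b[ (EFin \o f) ->
  {in `]a, b[, continuous f} ->
  (forall x, x \in `]a, b[ -> is_derive x 1 F (f x)) ->
  {within `[a, b], continuous F} ->
  \int[lebesgue_measure]_(x in `]a, b[) f x = F b - F a.
Proof.
move=> ab fi fc dF cF.
pose g := f \_ `]a, b[.
have gE x : x \in `]a, b[ -> g x = f x by move=> xab; rewrite /g patchE mem_set.
have gi : lebesgue_measure.-integrable setT (EFin \o g).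
  by rewrite /g -restrict_EFin; apply/integrable_restrict => //=; rewrite setTI.
have giA (A : set R) : measurable A -> lebesgue_measure.-integrable A (EFin \o g).
  by move=> mA; apply: integrableS gi.
have gc : {in `]a, b[, continuous g}.
  move=> x xab; have near_fg : \forall y \near x, f y = g y.
    by near=> y; rewrite gE//; near: y; exact: near_in_itvoo.
  rewrite /continuous_at gE //; apply: cvg_trans (fc _ xab).
  exact: near_eq_cvg.
pose H x := parameterized_integral lebesgue_measure a x g.
have dH x : x \in `]a, b[ -> is_derive x 1 H (f x).
  move=> xab; have := xab; rewrite in_itv/= => /andP[ax xb].
  have [||//|//|d1 d2] := @continuous_FTC1 R g (BLeft a) x b.
  - exact: xb.
  - exact: giA.
  - exact: gc.
  apply: DeriveDef => //; rewrite -derive1E.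
  by rewrite [LHS]d2 gE.
have cH : {within `[a, b], continuous H}.
  by apply: parameterized_integral_continuous; [exact: ltW|exact: giA].
have dHF x : x \in `]a, b[ -> is_derive x 1 (H - F) 0.
  move=> xab; have h1 := dH _ xab; have h2 := dF _ xab.
  by apply: is_derive_eq; rewrite subrr.
have cHF : {within `[a, b], continuous (H - F)}.
  by move=> x; apply: continuousB; [exact: cH|exact: cF].
have [c _] := MVT ab dHF cHF; rewrite mul0r !fctE.
have -> : H a = 0.
  by rewrite /H /parameterized_integral set_itv1 Rintegral_set1.
have -> : H b = \int[lebesgue_measure]_(x in `]a, b[) f x.
  rewrite /H /parameterized_integral.
  rewrite -Rintegral_itv_obnd_cbnd; last exact: giA.
  rewrite -Rintegral_itv_bndo_bndc; last exact: giA.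
  by apply: eq_Rintegral => x; rewrite inE /= => /gE.
lra.
Unshelve. all: by end_near. Qed.

(** * The weight as a function of the angle *)

Section Weight.
Variables (R : realType) (lambda eta : R).

(** A single power of [2 sin (t / 2)] makes the critical exponent visible: one more sine factor
    turns [2 lambda] into [2 lambda + 1], which is positive exactly when [lambda > -1/2]. *)
Definition circle_density (t : R) : R :=
  expR (- eta * (t - pi)) * (2 * sin (t / 2)) `^ (2 * lambda).

Lemma sin_half_gt0 (t : R) : 0 < t < 2 * pi -> 0 < sin (t / 2).
Proof.
move=> /andP[t0 t2]; apply: sin_gt0_pi; rewrite divr_gt0 //=.
by rewrite ltr_pdivrMr // mulrC.
Qed.

Lemma circle_weight_expi (t : R) : 0 < t < 2 * pi ->
  circle_weight (lambda +i* eta) (expi t) = (circle_density t)%:C.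
Proof.
move=> ht; rewrite circle_weightE // /circle_density.
have s0 := sin_half_gt0 ht.
have -> : 4 * sin (t / 2) ^+ 2 = (2 * sin (t / 2)) ^+ 2 by ring.
by rewrite -powR_mulrn ?mulr_ge0 ?ltW // -powRrM.
Qed.

Lemma circle_density_gt0 (t : R) : 0 < t < 2 * pi -> 0 < circle_density t.
Proof.
move=> /sin_half_gt0 s0.
by rewrite mulr_gt0 ?expR_gt0 // powR_gt0 // mulr_gt0.
Qed.

Lemma is_derive_circle_density (t : R) : 0 < t < 2 * pi ->
  is_derive t 1 circle_density
    (circle_density t * (- eta + lambda * (cos (t / 2) / sin (t / 2)))).
Proof.
move=> /sin_half_gt0 s0.
have u0 : 0 < 2 * sin (t / 2) by rewrite mulr_gt0.
have dhalf : is_derive t 1 (fun x : R => x / 2) 2^-1.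
  by apply: is_derive_eq; rewrite /GRing.scale /=; ring.
have ds : is_derive t 1 (fun x : R => sin (x / 2)) (cos (t / 2) * 2^-1).
  exact: (@is_derive1_comp R sin (fun x => x / 2) _ _ _ (is_derive_sin _) dhalf).
have du : is_derive t 1 (fun x : R => 2 * sin (x / 2)) (cos (t / 2)).
  by apply: is_derive_eq; rewrite /GRing.scale /=; field.
have dp : is_derive t 1 (fun x : R => (2 * sin (x / 2)) `^ (2 * lambda))
    ((2 * lambda) * (2 * sin (t / 2)) `^ (2 * lambda - 1) * cos (t / 2)).
  exact: (@is_derive1_comp R (fun u => u `^ (2 * lambda))
    (fun x => 2 * sin (x / 2)) _ _ _ (is_derive1_powR (2 * lambda) u0) du).
have de : is_derive t 1 (fun x : R => expR (- eta * (x - pi)))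
    (expR (- eta * (t - pi)) * - eta).
  have dl : is_derive t 1 (fun x : R => - eta * (x - pi)) (- eta).
    by apply: is_derive_eq; rewrite /GRing.scale /=; ring.
  exact: (@is_derive1_comp R expR (fun x => - eta * (x - pi)) _ _ _
    (is_derive_expR _) dl).
rewrite /circle_density; apply: is_derive_eq.
rewrite /GRing.scale /= powRB; last by rewrite (gt_eqF u0) implybT.
rewrite powRr1 ?(ltW u0) //; field; exact: lt0r_neq0.
Qed.

(** The exponential factor is controlled by [|t - pi| <= pi]; the extra sine raises the exponent of
    the power by one. *)
Lemma circle_density_le (t : R) : 0 < t < 2 * pi ->
  circle_density t * sin (t / 2) <=
  expR (`|eta| * pi) * (2 * sin (t / 2)) `^ (2 * lambda + 1).
Proof.
move=> ht; have s0 := sin_half_gt0 ht.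
have u0 : 0 < 2 * sin (t / 2) by rewrite mulr_gt0.
rewrite powRD; last by rewrite (gt_eqF u0) implybT.
rewrite powRr1 ?(ltW u0) // /circle_density -mulrA ler_pM ?expR_ge0 //.
- by rewrite mulr_ge0 ?powR_ge0 ?ltW.
- rewrite ler_expR (le_trans (ler_norm _)) // normrM normrN ler_wpM2l //.
  by rewrite ler_norml; move: ht => /andP[? ?]; apply/andP; split; lra.
- by rewrite ler_wpM2l ?powR_ge0 //; lra.
Qed.

(** Squeezed between two multiples of a positive power of [2 sin (t / 2)]. The filter stays abstract
    so that one proof serves both the limit at 0 from the right and at [2 pi] from the left. *)
Lemma cvg_circle_density_mul0 (F : set_system R) (phi : R -> R) (C : R) :
  ProperFilter F -> - (1 / 2) < lambda ->
  (\forall t \near F, 0 < t < 2 * pi) ->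
  sin (t / 2) @[t --> F] --> 0 ->
  (\forall t \near F, `|phi t| <= C * sin (t / 2)) ->
  circle_density t * phi t @[t --> F] --> 0.
Proof.
move=> PF l0 F02 Fs Fphi.
have c0 : 0 < 2 * lambda + 1 by lra.
have Fu : 2 * sin (t / 2) @[t --> F] --> 0^'+.
  move=> A [e /= e0 eA]; suff : \forall t \near F, A (2 * sin (t / 2)) by [].
  near=> t; apply: eA => /=; last first.
    by rewrite mulr_gt0 // sin_half_gt0 //; near: t.
  have s0 : 0 < sin (t / 2) by apply: sin_half_gt0; near: t.
  rewrite sub0r normrN gtr0_norm ?mulr_gt0 //.
  have : `|0 - sin (t / 2)| < e / 2.
    by near: t; apply: cvgr_dist_lt => //; rewrite divr_gt0.
  by rewrite sub0r normrN gtr0_norm // ltr_pdivlMr // mulrC.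
have Fp : expR (`|eta| * pi) * `|C| * (2 * sin (t / 2)) `^ (2 * lambda + 1)
    @[t --> F] --> 0.
  rewrite -(mulr0 (expR (`|eta| * pi) * `|C|)).
  apply: cvgM; first exact: cvg_cst.
  exact: (cvg_comp _ _ Fu (powR_cvg0 c0)).
have Fn := cvgN Fp; rewrite oppr0 in Fn.
pose bnd t := expR (`|eta| * pi) * `|C| * (2 * sin (t / 2)) `^ (2 * lambda + 1).
apply: (@squeeze_cvgr _ F _ R (- bnd) bnd); [|exact: Fn|exact: Fp].
near=> t.
rewrite fctE /bnd.
rewrite -ler_norml normrM.
have ht : 0 < t < 2 * pi by near: t.
have w0 := circle_density_gt0 ht; have s0 := sin_half_gt0 ht.
rewrite gtr0_norm //.
(* Nothing is assumed on the sign of [C], hence [|C|] in the bound. *)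
have hphi : `|phi t| <= `|C| * sin (t / 2).
  by apply: (@le_trans _ _ (C * sin (t / 2))); [near: t|rewrite ler_wpM2r ?ler_norm ?ltW].
apply: (le_trans (ler_wpM2l (ltW w0) hphi)).
rewrite mulrCA [leRHS]mulrAC [leRHS]mulrC ler_wpM2l //.
exact: circle_density_le.
Unshelve. all: by end_near. Qed.

(** The integrand is the derivative of density times [phi]. The bound on [phi] supplies the sine
    factor that beats the singularity, so no boundary term survives. *)
Lemma Rintegral_circle_density0 (phi psi : R -> R) (C : R) :
  - (1 / 2) < lambda ->
  lebesgue_measure.-integrable `]0, 2 * pi[
    (EFin \o (fun t => circle_density t * psi t)) ->
  (forall t, 0 < t < 2 * pi -> {for t, continuous psi}) ->
  (forall t, 0 < t < 2 * pi ->
     is_derive t 1 (fun x => circle_density x * phi x)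
       (circle_density t * psi t)) ->
  (forall t, 0 <= t <= 2 * pi -> `|phi t| <= C * sin (t / 2)) ->
  \int[lebesgue_measure]_(t in `]0, 2 * pi[) (circle_density t * psi t) = 0.
Proof.
move=> l0 iw cpsi dphi bphi.
have pi0 := pi_gt0 R.
have p2 : 0 < 2 * pi :> R by rewrite mulr_gt0.
have p22 : 2 * pi / 2 = pi :> R by field.
have inE02 x : (x \in `]0, (2 * pi : R)[) -> 0 < x < 2 * pi by rewrite in_itv.
have end0 x : sin (x / 2) = 0 -> 0 <= x <= 2 * pi -> phi x = 0.
  by move=> s0 /bphi; rewrite s0 mulr0 normr_le0 => /eqP.
(* At the endpoints the power has base 0; since [phi] vanishes there, the product is 0 whatever
   value the power takes, which agrees with its limits. *)
have e0 : phi 0 = 0.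
  by apply: end0; rewrite ?mul0r ?sin0 // lexx ltW.
have e1 : phi (2 * pi) = 0.
  by apply: end0; rewrite ?lexx ?ltW // p22 sinpi.
have csin : continuous (fun t : R => sin (t / 2)).
  move=> t; apply: continuous_comp; last exact: continuous_sin.
  by apply: cvgM; [exact: cvg_id|exact: cvg_cst].
rewrite (@Rintegral_derivative_oo R _ (fun x => circle_density x * phi x)) //.
- by rewrite e0 e1 !mulr0 subrr.
- move=> x /inE02 hx; apply: cvgM; last exact: cpsi.
  apply: differentiable_continuous; apply/derivable1_diffP.
  by have := is_derive_circle_density hx; case.
apply/(continuous_within_itvP _ p2); split.
- move=> x /inE02 hx; apply: differentiable_continuous; apply/derivable1_diffP.
  by have := dphi _ hx; case.
- rewrite e0 mulr0; apply: (@cvg_circle_density_mul0 _ _ C) => //.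
  + near=> t; apply/andP; split; first by near: t; exact: nbhs_right_gt.
    by near: t; exact: nbhs_right_lt.
  + apply: cvg_at_right_filter.
    by have := csin 0; rewrite /continuous_at mul0r sin0.
  + near=> t; apply: bphi; apply/andP; split; first by near: t; exact: nbhs_right_ge.
    by near: t; exact: nbhs_right_le.
- rewrite e1 mulr0; apply: (@cvg_circle_density_mul0 _ _ C) => //.
  + near=> t; apply/andP; split; first by near: t; exact: nbhs_left_gt.
    by near: t; exact: nbhs_left_lt.
  + apply: cvg_at_left_filter.
    by have := csin (2 * pi); rewrite /continuous_at p22 sinpi.
  + near=> t; apply: bphi; apply/andP; split; first by near: t; exact: nbhs_left_ge.
    by near: t; exact: nbhs_left_le.
Unshelve. all: by end_near. Qed.

End Weight.

(** * Calculus of complex-valued functions of a real variable *)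

Section ComplexCurves.
Variable R : realType.
Implicit Types (f g : R -> R[i]) (x y z : R[i]) (p : {poly R[i]}).

Lemma complexReD x y : Re (x + y) = Re x + Re y. Proof. by case: x y => ? ? []. Qed.
Lemma complexImD x y : Im (x + y) = Im x + Im y. Proof. by case: x y => ? ? []. Qed.
Lemma complexReN x : Re (- x) = - Re x. Proof. by case: x. Qed.
Lemma complexImN x : Im (- x) = - Im x. Proof. by case: x. Qed.
Lemma complexReM x y : Re (x * y) = Re x * Re y - Im x * Im y.
Proof. by case: x y => ? ? []. Qed.
Lemma complexImM x y : Im (x * y) = Re x * Im y + Im x * Re y.
Proof. by case: x y => ? ? []. Qed.

Lemma complexRe_conj z : Re z^* = Re z. Proof. by case: z. Qed.
Lemma complexIm_conj z : Im z^* = - Im z. Proof. by case: z. Qed.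

Lemma complexRe_i : Re ('i : R[i]) = 0. Proof. by rewrite -complexiE. Qed.
Lemma complexIm_i : Im ('i : R[i]) = 1. Proof. by rewrite -complexiE. Qed.

Lemma complex_eqP x y : Re x = Re y -> Im x = Im y -> x = y.
Proof. by case: x y => ? ? [? ?] /= -> ->. Qed.

(** Continuity and derivatives of curves are taken componentwise, like the circle integral, so that
    real analysis applies to each part directly. *)
Definition continuous_curve f :=
  continuous (fun t => Re (f t)) /\ continuous (fun t => Im (f t)).

Definition is_derive_curve f f' (t : R) :=
  is_derive t 1 (fun t => Re (f t)) (Re (f' t)) /\
  is_derive t 1 (fun t => Im (f t)) (Im (f' t)).

Lemma is_derive_curve_continuous f f' :
  (forall t, is_derive_curve f f' t) -> continuous_curve f.
Proof.
move=> df; split=> t; apply: differentiable_continuous; apply/derivable1_diffP.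
  by have [[]] := df t.
by have [_ []] := df t.
Qed.

Lemma continuous_curve_cst z : continuous_curve (fun=> z).
Proof. by split=> t; exact: cvg_cst. Qed.

Lemma continuous_curveD f g : continuous_curve f -> continuous_curve g ->
  continuous_curve (fun t => f t + g t).
Proof.
move=> [f1 f2] [g1 g2]; split=> t.
  under eq_fun do rewrite complexReD.
  by apply: cvgD; [exact: f1|exact: g1].
under eq_fun do rewrite complexImD.
by apply: cvgD; [exact: f2|exact: g2].
Qed.

Lemma continuous_curveM f g : continuous_curve f -> continuous_curve g ->
  continuous_curve (fun t => f t * g t).
Proof.
move=> [f1 f2] [g1 g2]; split=> t.
  under eq_fun do rewrite complexReM.
  by apply: cvgB; apply: cvgM; [exact: f1|exact: g1|exact: f2|exact: g2].
under eq_fun do rewrite complexImM.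
by apply: cvgD; apply: cvgM; [exact: f1|exact: g2|exact: f2|exact: g1].
Qed.

Lemma continuous_curve_conj f : continuous_curve f ->
  continuous_curve (fun t => (f t)^*).
Proof.
move=> [f1 f2]; split=> t.
  by under eq_fun do rewrite complexRe_conj; exact: f1.
by under eq_fun do rewrite complexIm_conj; apply: cvgN; exact: f2.
Qed.

Lemma continuous_curve_horner f p : continuous_curve f ->
  continuous_curve (fun t => p.[f t]).
Proof.
move=> cf; elim/poly_ind: p => [|p c IH].
  by under eq_fun do rewrite horner0; exact: continuous_curve_cst.
under eq_fun do rewrite hornerMXaddC.
apply: continuous_curveD; last exact: continuous_curve_cst.
exact: continuous_curveM.
Qed.

Lemma complexReV z : Re z^-1 = Re z / (Re z ^+ 2 + Im z ^+ 2).
Proof. by case: z. Qed.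
Lemma complexImV z : Im z^-1 = - (Im z / (Re z ^+ 2 + Im z ^+ 2)).
Proof. by case: z. Qed.

Lemma sqr_norm_neq0 z : z != 0 -> Re z ^+ 2 + Im z ^+ 2 != 0.
Proof.
apply: contraNN; rewrite paddr_eq0 ?sqr_ge0 // !sqrf_eq0 => /andP[/eqP a /eqP b].
by apply/eqP/complex_eqP.
Qed.

Lemma is_derive_curve_cst z t : is_derive_curve (fun=> z) (fun=> 0) t.
Proof. by split; exact: is_derive_cst. Qed.

Lemma is_derive_curveD f f' g g' t :
  is_derive_curve f f' t -> is_derive_curve g g' t ->
  is_derive_curve (fun t => f t + g t) (fun t => f' t + g' t) t.
Proof.
move=> [f1 f2] [g1 g2]; split.
  by under eq_fun do rewrite complexReD; rewrite complexReD; exact: is_deriveD.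
by under eq_fun do rewrite complexImD; rewrite complexImD; exact: is_deriveD.
Qed.

Lemma is_derive_curveM f f' g g' t :
  is_derive_curve f f' t -> is_derive_curve g g' t ->
  is_derive_curve (fun t => f t * g t) (fun t => f' t * g t + f t * g' t) t.
Proof.
move=> [f1 f2] [g1 g2]; split.
  under eq_fun do rewrite complexReM.
  apply: is_derive_eq; rewrite complexReD !complexReM /GRing.scale /=; ring.
under eq_fun do rewrite complexImM.
apply: is_derive_eq; rewrite complexImD !complexImM /GRing.scale /=; ring.
Qed.

Lemma is_derive_curveV f f' t : f t != 0 ->
  is_derive_curve f f' t ->
  is_derive_curve (fun t => (f t)^-1) (fun t => - (f' t / f t ^+ 2)) t.
Proof.
move=> f0 [f1 f2]; have N0 := sqr_norm_neq0 f0.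
have dN : is_derive t 1 (fun t => Re (f t) ^+ 2 + Im (f t) ^+ 2)
   (2 * (Re (f t) * Re (f' t) + Im (f t) * Im (f' t))).
  apply: is_derive_eq; rewrite /GRing.scale /= /GRing.scale /=; ring.
have dV := @is_deriveV R (fun t => Re (f t) ^+ 2 + Im (f t) ^+ 2) t _ _ N0 dN.
rewrite /is_derive_curve -exprVn complexReN complexImN expr2.
split.
  under eq_fun do rewrite complexReV.
  apply: is_derive_eq; rewrite !(complexReM, complexImM) !(complexReV, complexImV) /GRing.scale /=.
  by field.
under eq_fun do rewrite complexImV.
apply: is_derive_eq; rewrite !(complexReM, complexImM) !(complexReV, complexImV) /GRing.scale /=.
by field.
Qed.

Lemma is_derive_curve_horner f f' p t : is_derive_curve f f' t ->
  is_derive_curve (fun t => p.[f t]) (fun t => p^`().[f t] * f' t) t.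
Proof.
move=> df; elim/poly_ind: p => [|p c IH].
  under eq_fun do rewrite horner0.
  under [X in is_derive_curve _ X]eq_fun do rewrite deriv0 horner0 mul0r.
  exact: is_derive_curve_cst.
under eq_fun do rewrite hornerMXaddC.
have := is_derive_curveD (is_derive_curveM IH df) (is_derive_curve_cst c t).
congr is_derive_curve; apply/funext => u.
rewrite derivD derivM derivX derivC !hornerE; ring.
Qed.

Lemma is_derive_curve_expi t : is_derive_curve (@expi R) (fun t => 'i * expi t) t.
Proof.
rewrite /is_derive_curve complexReM complexImM complexRe_i complexIm_i; split=> /=.
  by apply: is_derive_eq; ring.
by apply: is_derive_eq; ring.
Qed.

Lemma is_derive_curve_conj f f' t : is_derive_curve f f' t ->
  is_derive_curve (fun t => (f t)^*) (fun t => (f' t)^*) t.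
Proof.
move=> [f1 f2]; split.
  by under eq_fun do rewrite complexRe_conj; rewrite complexRe_conj.
by under eq_fun do rewrite complexIm_conj; rewrite complexIm_conj; exact: is_deriveN.
Qed.

End ComplexCurves.

(** * The integral against the density as a linear functional *)

Section WeightedIntegral.
Variables (R : realType) (lambda eta : R).
Hypothesis lambda_gt : - (1 / 2) < lambda.
Local Notation w := (circle_density lambda eta).
Local Notation b := (lambda +i* eta).
Local Notation mu := (@lebesgue_measure R).
Hypothesis w_integrable : mu.-integrable `]0, 2 * pi[ (EFin \o w).
Implicit Types (f g : R -> R[i]) (phi : R -> R).

Definition weighted_integral f : R[i] :=
  (\int[mu]_(t in `]0, 2 * pi[) (w t * Re (f t))) +i*
  (\int[mu]_(t in `]0, 2 * pi[) (w t * Im (f t))).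
Local Notation J := weighted_integral.

Lemma continuous_bounded_02pi phi : continuous phi ->
  exists M, forall t, 0 <= t <= 2 * pi -> `|phi t| <= M.
Proof.
move=> cphi; have p0 : 0 <= 2 * pi :> R by rewrite mulr_ge0 ?pi_ge0.
have cn : continuous (fun t => `|phi t|).
  by move=> t; apply: cvg_norm; exact: cphi.
have [||c _ hc] := @EVT_max R (fun t => `|phi t|) 0 (2 * pi).
- by [].
- exact: continuous_subspaceT.
by exists `|phi c| => t ht; apply: hc; rewrite in_itv.
Qed.

Lemma density_integrable phi : continuous phi ->
  mu.-integrable `]0, 2 * pi[ (EFin \o (fun t => w t * phi t)).
Proof.
move=> cphi; apply: (integrableMl _ w_integrable) => //.
  by apply: measurable_funTS; exact: continuous_measurable_fun.
have [M hM] := continuous_bounded_02pi cphi.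
exists M; split; first exact: num_real.
move=> y My t /=; rewrite in_itv /= => /andP[t0 t2].
by apply: (le_trans (hM _ _) (ltW My)); rewrite !ltW.
Qed.

Lemma eq_weighted_integral f g :
  (forall t, 0 < t < 2 * pi -> f t = g t) -> J f = J g.
Proof.
move=> fg; apply: complex_eqP => /=; apply: eq_Rintegral => t;
  by rewrite inE /= in_itv /= => /fg ->.
Qed.

Lemma weighted_integralD f g : continuous_curve f -> continuous_curve g ->
  J (fun t => f t + g t) = J f + J g.
Proof.
move=> [f1 f2] [g1 g2]; apply: complex_eqP => /=; rewrite -RintegralD //;
  try exact: density_integrable.
  by apply: eq_Rintegral => t _; rewrite complexReD mulrDr.
by apply: eq_Rintegral => t _; rewrite complexImD mulrDr.
Qed.

Lemma weighted_integralZ c f : continuous_curve f ->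
  J (fun t => c * f t) = c * J f.
Proof.
move=> [f1 f2]; have i1 := density_integrable f1; have i2 := density_integrable f2.
have hZ (k : R) phi : continuous phi ->
    \int[mu]_(t in `]0, 2 * pi[) (w t * (k * phi t)) =
    k * \int[mu]_(t in `]0, 2 * pi[) (w t * phi t).
  move=> cphi; rewrite -RintegralZl //; last exact: density_integrable.
  by apply: eq_Rintegral => t _; ring.
have cZ (k : R) phi : continuous phi -> continuous (fun t => k * phi t).
  by move=> cphi t; apply: cvgM; [exact: cvg_cst|exact: cphi].
apply: complex_eqP.
  rewrite complexReM /= -!hZ // -RintegralB //; try by apply: density_integrable; exact: cZ.
  by apply: eq_Rintegral => t _; rewrite complexReM mulrBr.
rewrite complexImM /= -!hZ // -RintegralD //; try by apply: density_integrable; exact: cZ.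
by apply: eq_Rintegral => t _; rewrite complexImM mulrDr.
Qed.

Lemma weighted_integral_conj f : continuous_curve f ->
  J (fun t => (f t)^*) = (J f)^*.
Proof.
move=> [f1 f2]; apply: complex_eqP; rewrite ?complexRe_conj ?complexIm_conj /=.
  by apply: eq_Rintegral => t _; rewrite complexRe_conj.
rewrite -mulN1r -RintegralZl //; last exact: density_integrable.
by apply: eq_Rintegral => t _; rewrite complexIm_conj; ring.
Qed.

(** The factor 2 comes from bounding the real and imaginary parts separately; the constant is
    irrelevant for the remainder estimates that use it. *)
Lemma norm_weighted_integral_le f M : continuous_curve f ->
  (forall t, `|f t| <= M%:C) ->
  `|J f| <= (2 * M * \int[mu]_(t in `]0, 2 * pi[) w t)%:C.
Proof.
move=> [f1 f2] fM.
have cM (k : R) : continuous (fun _ : R => k) by move=> t; exact: cvg_cst.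
have hI phi : continuous phi -> (forall t, `|phi t| <= M) ->
    `|\int[mu]_(t in `]0, 2 * pi[) (w t * phi t)| <=
    M * \int[mu]_(t in `]0, 2 * pi[) w t.
  move=> cphi hphi.
  have hk (k : R) : \int[mu]_(t in `]0, 2 * pi[) (w t * k) =
      k * \int[mu]_(t in `]0, 2 * pi[) w t.
    by rewrite -RintegralZl //; apply: eq_Rintegral => t _; rewrite mulrC.
  have w0 t : `]0, 2 * pi[%classic t -> 0 <= w t.
    by rewrite /= in_itv => /circle_density_gt0 /ltW ->.
  rewrite ler_norml -mulNr -!hk; apply/andP; split; apply: le_Rintegral => //;
    try exact: density_integrable; try exact: (density_integrable (cM _)).
    by move=> t /w0 ?; rewrite ler_wpM2l //; have := hphi t; rewrite ler_norml => /andP[].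
  by move=> t /w0 ?; rewrite ler_wpM2l //; have := hphi t; rewrite ler_norml => /andP[].
have normR (x : R) : `|x%:C| = `|x|%:C.
  by rewrite normc_def /= expr0n /= addr0 sqrtr_sqr.
rewrite [J f]complexE (le_trans (ler_normD _ _)) // normrM.
rewrite complexiE normCi mul1r !normR -rmorphD /= lecR.
have -> : 2 * M * \int[mu]_(t in `]0, 2 * pi[) w t =
  M * \int[mu]_(t in `]0, 2 * pi[) w t + M * \int[mu]_(t in `]0, 2 * pi[) w t by ring.
apply: lerD; apply: hI => // t; rewrite -lecR (le_trans _ (fM t)) //.
  exact: normc_ge_Re.
(* The imaginary part is a real part after multiplication by [- 'i], so the same inequality covers
   it. *)
have -> : Im (f t) = Re (- 'i * f t) by rewrite complexReM complexReN complexImN complexRe_i complexIm_i; ring.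
by rewrite (le_trans (normc_ge_Re _)) // normrM normrN normCi mul1r.
Qed.

End WeightedIntegral.

(** * Integrability of the weight and its Pearson equation *)

Section Pearson.
Variables (R : realType) (lambda eta : R).
Local Notation w := (circle_density lambda eta).
Local Notation b := (lambda +i* eta : R[i]).
Local Notation mu := (@lebesgue_measure R).
Local Notation J := (weighted_integral lambda eta).
Local Notation e := (@expi R).
Implicit Types (f g : R -> R[i]).

(** The density is real, so it factors out of both components. The identity is asked on the open
    interval only, since the point 1 is left out of the circle integral. *)
Lemma circle_integral_weighted (F : R[i] -> R[i]) g :
  (forall t, 0 < t < 2 * pi -> F (e t) * ('i * e t) = (w t)%:C * g t) ->
  circle_integral F = J g.
Proof.
move=> hF; apply: complex_eqP => /=; apply: eq_Rintegral => t;
  rewrite inE /= in_itv /= => /hF ->.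
  by rewrite complexReM /= mul0r subr0.
by rewrite complexImM /= mul0r addr0.
Qed.

Lemma expi_neq0 (t : R) : e t != 0.
Proof.
apply: contra_eq_neq (cos2Dsin2 t) => /eqP; rewrite eq_complex /=.
by move=> /andP[/eqP -> /eqP ->]; rewrite expr0n /= addr0 eq_sym oner_eq0.
Qed.

Lemma expi_conj (t : R) : (e t)^* = (e t)^-1.
Proof.
apply: complex_eqP; rewrite ?complexRe_conj ?complexIm_conj.
  by rewrite complexReV /= cos2Dsin2 divr1.
by rewrite complexImV /= cos2Dsin2 divr1.
Qed.

Lemma norm_expi (t : R) : `|e t| = 1.
Proof. by rewrite normc_def /= cos2Dsin2 sqrtr1. Qed.

(** If the positive density had infinite integral, its real-valued integral would be [fine +oo = 0],
    whereas the relation at [n = m = 0] makes it [kappa_0 ^- 2 > 0]. No estimate of the singularity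
    is needed. *)
Lemma circle_density_integrable (Phi : nat -> {poly R[i]}) (kappa : nat -> R) :
  monic_opuc (circle_weight b) Phi kappa ->
  mu.-integrable `]0, 2 * pi[ (EFin \o w).
Proof.
move=> /(_ 0%N)[mon sz k0 /(_ 0%N)].
have P1 : Phi 0%N = 1.
  have P0 := size1_polyC (eq_leq sz).
  by move: mon; rewrite P0 monicE lead_coefC => /eqP ->.
rewrite P1 (@circle_integral_weighted _ (fun=> 1)); last first.
  move=> t ht; rewrite -polyC1 !hornerC rmorph1 circle_weight_expi // ?mulr1 ?mul1r.
  by rewrite divfK // mulf_neq0 ?expi_neq0 // neq0Ci.
move=> /(congr1 (@Re R)) /=.
under eq_Rintegral do rewrite mulr1.
move=> hw.
have mw : measurable_fun (`]0, 2 * pi[%classic : set R) w.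
  apply: open_continuous_measurable_fun; first exact: interval_open.
  move=> t; rewrite inE /= in_itv /= => ht.
  apply: differentiable_continuous; apply/derivable1_diffP.
  by have [] := is_derive_circle_density lambda eta ht.
apply/integrableP; split; first exact/measurable_EFinP.
rewrite ltey; apply/eqP => hoo.
have : \int[mu]_(t in `]0, 2 * pi[) w t = 0.
  rewrite /Rintegral -[RHS]/(fine +oo%E) -hoo; congr fine.
  apply: eq_integral => t; rewrite inE /= in_itv /= => /(circle_density_gt0 lambda eta) w0.
  by rewrite gtr0_norm.
rewrite hw => /eqP; rewrite /= mulr1n gt_eqF // invr_gt0 exprn_gt0 //.
Qed.

(* Half-angle form of the Pearson equation [(z - 1) z nu' = (b z + conj b) nu]. *)
Lemma circle_density_log_derivative (t : R) : 0 < t < 2 * pi ->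
  (- eta + lambda * (cos (t / 2) / sin (t / 2)))%:C * (e t - 1) =
  'i * (b * e t + b^*).
Proof.
move=> /sin_half_gt0 s0.
have tE : t = (t / 2) *+ 2 by rewrite -mulr_natr divfK // pnatr_eq0.
have -> : e t = (1 - 2 * sin (t / 2) ^+ 2) +i* (2 * cos (t / 2) * sin (t / 2)).
  rewrite /expi {1 2}tE cos_mulr2n sin_mulr2n; apply: complex_eqP => /=; rewrite mulr2n.
    by rewrite cos2sin2; ring.
  by ring.
have c2 := cos2sin2 (t / 2).
have sN := lt0r_neq0 s0.
apply: complex_eqP; rewrite ?(complexReM, complexImM) complexRe_i complexIm_i /=.
  by field.
set c := cos _ in c2 *; set s := sin _ in c2 sN *.
transitivity (- eta * (2 * c * s) + 2 * lambda * c ^+ 2); first by field.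
by rewrite c2; ring.
Qed.

Hypothesis lambda_gt : - (1 / 2) < lambda.
Hypothesis w_integrable : mu.-integrable `]0, 2 * pi[ (EFin \o w).

Lemma expi_continuous : continuous_curve e.
Proof. exact/is_derive_curve_continuous/is_derive_curve_expi. Qed.

(** Times the density, the integrand is the derivative of density times [(e t - 1) * g t]: the
    logarithmic derivative of the density has a pole at the point 1, which the factor [e t - 1]
    removes. *)
Lemma weighted_integral_pearson g g' :
  (forall t, is_derive_curve g g' t) -> continuous_curve g' ->
  J (fun t => 'i * ((b + 1) * e t + b^*) * g t + (e t - 1) * g' t) = 0.
Proof.
(* Real parts suffice: the imaginary part is the real part of the same relation for [- 'i * g]. *)
suff ReJ0 h h' : (forall t, is_derive_curve h h' t) -> continuous_curve h' ->
    \int[mu]_(t in `]0, 2 * pi[) (w t *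
      Re ('i * ((b + 1) * e t + b^*) * h t + (e t - 1) * h' t)) = 0.
  move=> dg cg; apply: complex_eqP => /=; first exact: ReJ0.
  rewrite -[RHS](ReJ0 (fun t => - 'i * g t) (fun t => - 'i * g' t)).
  - apply: eq_Rintegral => t _; congr (_ * _).
    set z := (X in Im X = _).
    rewrite [X in _ = Re X](_ : _ = - 'i * z); last by rewrite /z; ring.
    by rewrite complexReM complexReN complexImN complexRe_i complexIm_i; ring.
  - move=> t; have := is_derive_curveM (is_derive_curve_cst (- 'i) t) (dg t).
    by congr is_derive_curve; apply/funext => u; rewrite mul0r add0r.
  - by apply: continuous_curveM => //; exact: continuous_curve_cst.
move=> dh ch'.
have ch := is_derive_curve_continuous dh.
have ce := expi_continuous.
have dphi t : is_derive_curve (fun t => (e t - 1) * h t)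
    (fun t => 'i * e t * h t + (e t - 1) * h' t) t.
  have := is_derive_curveM (is_derive_curveD (is_derive_curve_expi t)
    (is_derive_curve_cst (-1) t)) (dh t).
  by congr is_derive_curve; apply/funext => u; rewrite addr0.
have cc z := @continuous_curve_cst R z.
have cint : continuous_curve (fun t =>
    'i * ((b + 1) * e t + b^*) * h t + (e t - 1) * h' t) :=
  continuous_curveD (continuous_curveM (continuous_curveM (cc 'i)
    (continuous_curveD (continuous_curveM (cc (b + 1)) ce) (cc b^*))) ch)
    (continuous_curveM (continuous_curveD ce (cc (- 1))) ch').
have [M1 hM1] := continuous_bounded_02pi ch.1.
have [M2 hM2] := continuous_bounded_02pi ch.2.
apply: (@Rintegral_circle_density0 _ _ _ (fun t => Re ((e t - 1) * h t)) _ (2 * (M1 + M2))); first exact: lambda_gt.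
- by apply: density_integrable => //; exact: cint.1.
- by move=> t _; exact: cint.1.
- move=> t ht; have [d1 _] := dphi t.
  have dw := is_derive_circle_density lambda eta ht.
  apply: is_derive_eq; rewrite /GRing.scale /=.
  set k := - eta + _.
  have hk : k * Re ((e t - 1) * h t) = Re ('i * (b * e t + b^*) * h t).
    by rewrite -(circle_density_log_derivative ht) -mulrA [RHS]complexReM /= mul0r subr0.
  transitivity (w t * (k * Re ((e t - 1) * h t) +
    Re ('i * e t * h t + (e t - 1) * h' t))); first by ring.
  by rewrite hk -complexReD; congr (_ * Re _); ring.
- move=> t ht.
  have tE : t = (t / 2) *+ 2 by rewrite -mulr_natr divfK // pnatr_eq0.
  have s0 : 0 <= sin (t / 2).
    apply: sin_ge0_pi; move: ht => /andP[t0 t2]; rewrite divr_ge0 //=.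
    by rewrite ler_pdivrMr // mulrC.
  (* Half-angle factorisation: [e^(it) - 1] is [2 sin (t / 2)] times the unimodular number
     [- sin (t / 2) + i cos (t / 2)]. With [M1] and [M2] bounding the parts of [h], this gives the
     constant [2 (M1 + M2)]. *)
  have -> : Re ((e t - 1) * h t) = - (2 * sin (t / 2)) *
      (sin (t / 2) * Re (h t) + cos (t / 2) * Im (h t)).
    have ec : cos t = 1 - 2 * sin (t / 2) ^+ 2.
      by rewrite {1}tE cos_mulr2n cos2sin2 mulr2n; ring.
    have es : sin t = 2 * sin (t / 2) * cos (t / 2).
      by rewrite {1}tE sin_mulr2n mulr2n; ring.
    by rewrite complexReM /expi /= ec es; ring.
  have s20 : 0 <= 2 * sin (t / 2) by rewrite mulr_ge0.
  rewrite normrM normrN (ger0_norm s20) [leRHS]mulrAC ler_wpM2l //.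
  have s1 : `|sin (t / 2)| <= 1 by rewrite ler_norml sin_geN1 sin_le1.
  have c1 : `|cos (t / 2)| <= 1 by rewrite ler_norml cos_geN1 cos_le1.
  rewrite (le_trans (ler_normD _ _)) // !normrM lerD //.
    by apply: le_trans (hM1 _ ht); rewrite ler_piMl.
  by apply: le_trans (hM2 _ ht); rewrite ler_piMl.
Qed.

End Pearson.

(** * The hypergeometric operator on coefficients *)

Section HypergeometricOperator.
Variables (R : realType) (b : R[i]).
Implicit Types p : {poly R[i]}.

(** The equations of [Phi_n] and of the reversed polynomial differ only in the zeroth-order
    constant, so [c] is a parameter. *)
Definition hypergeometric_op (n : nat) (c : R[i]) p : {poly R[i]} :=
  'X * (1 - 'X) * p^`()^`() +
  ((n%:R - b - 2)%:P * 'X + (1 - n%:R - b^*)%:P) * p^`() + c%:P * p.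

Lemma coef_hypergeometric_op n c p k :
  (hypergeometric_op n c p)`_k =
  (c + k%:R * (n%:R - k%:R - 1 - b)) * p`_k -
  k.+1%:R * (n%:R - k%:R - 1 + b^*) * p`_k.+1.
Proof.
have -> : hypergeometric_op n c p = 'X * p^`()^`() - 'X * ('X * p^`()^`()) +
   ((n%:R - b - 2)%:P * ('X * p^`()) + (1 - n%:R - b^*)%:P * p^`()) + c%:P * p.
  by rewrite /hypergeometric_op; ring.
have cd (q : {poly R[i]}) j : q^`()`_j = j.+1%:R * q`_j.+1.
  by rewrite coef_deriv mulr_natl.
rewrite !(coefD, coefN, coefCM, coefXM, cd).
case: k => [|[|k]] /=.
- by ring.
- by ring.
- by rewrite -!natr1; ring.
Qed.

Lemma horner_hypergeometric_op n c p (z : R[i]) :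
  (hypergeometric_op n c p).[z] =
  z * (1 - z) * (p^`(2)%R).[z] +
  ((n%:R - b - 2) * z + (1 - n%:R - b^*)) * (p^`()%R).[z] + c * p.[z].
Proof. by rewrite /hypergeometric_op !hornerE. Qed.

(** Reversal and conjugation exchange the two coefficients of each relation, so the recurrence of
    [p] becomes that of the reversed polynomial, with [N] raised by one. In degree [N] the diagonal
    factor vanishes. *)
Lemma hypergeometric_op_conj_rev (N : nat) p : (size p <= N.+1)%N ->
  hypergeometric_op N (N%:R * (1 + b)) p = 0 ->
  hypergeometric_op N.+1 (b * N%:R) (conj_rev N p) = 0.
Proof.
move=> sp Lp; apply/polyP => k; rewrite coef_hypergeometric_op coef0.
rewrite /conj_rev !coef_poly !ltnS.
case: (ltngtP k N) => [kN|kN|->]; last first.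
- by rewrite -natr1 !mulr0 !subr0; ring.
- by rewrite !mulr0 subr0.
(* Coefficients [k] and [k + 1] of the reversed polynomial are the conjugates of those of [p] at
   [N - k] and [N - k - 1], which are linked by the relation at index [N - k - 1]. *)
have := congr1 (fun q : {poly R[i]} => (q`_(N - k.+1))^*) Lp.
rewrite /= coef_hypergeometric_op -subSn // subSS coef0 rmorph0.
rewrite !(rmorphB, rmorphD, rmorphM, rmorph_nat, rmorph1) /= conjCK.
move: (p`_(N - k.+1)) (p`_(N - k)) => x y.
rewrite (natrB _ kN) (natrB _ (ltnW kN)) -!natr1 => h.
rewrite -[RHS]oppr0 -h.
have key (m j B x' y' : R[i]) :
    (b * m + j * (m + 1 - j - 1 - b)) * y' - (j + 1) * (m + 1 - j - 1 + B) * x' =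
    - ((m * (1 + B) + (m - (j + 1)) * (m - (m - (j + 1)) - 1 - B)) * x' -
       (m - j) * (m - (m - (j + 1)) - 1 + b) * y') by ring.
exact: key.
Qed.

End HypergeometricOperator.

(** * Orthogonality and the equation of [Phi_n] *)

Section Orthogonality.
Variables (R : realType) (lambda eta : R).
Variables (Phi : nat -> {poly R[i]}) (kappa : nat -> R).
Local Notation b := (lambda +i* eta : R[i]).
Local Notation J := (weighted_integral lambda eta).
Local Notation e := (@expi R).
Hypothesis lambda_gt : - (1 / 2) < lambda.
Hypothesis opuc : monic_opuc (circle_weight b) Phi kappa.
Implicit Types p q r : {poly R[i]}.

Let w_int := circle_density_integrable opuc.

Definition circle_inner p q : R[i] := J (fun t => p.[e t] * (q.[e t])^*).
Local Notation inner := circle_inner.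

Lemma continuous_horner_expi p : continuous_curve (fun t => p.[e t]).
Proof. exact/continuous_curve_horner/expi_continuous. Qed.
Local Hint Resolve continuous_horner_expi : core.

Lemma continuous_inner p q : continuous_curve (fun t => p.[e t] * (q.[e t])^*).
Proof. by apply: continuous_curveM => //; exact: continuous_curve_conj. Qed.
Local Hint Resolve continuous_inner : core.

Lemma circle_innerDl p q r : inner (p + q) r = inner p r + inner q r.
Proof.
rewrite /circle_inner -weighted_integralD //.
by apply: eq_weighted_integral => t _; rewrite hornerD mulrDl.
Qed.

Lemma circle_innerZl c p q : inner (c *: p) q = c * inner p q.
Proof.
rewrite /circle_inner -weighted_integralZ //.
by apply: eq_weighted_integral => t _; rewrite hornerZ mulrA.
Qed.

Lemma circle_innerC p q : inner p q = (inner q p)^*.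
Proof.
rewrite /circle_inner -weighted_integral_conj //.
by apply: eq_weighted_integral => t _; rewrite rmorphM /= conjCK mulrC.
Qed.

Lemma circle_innerDr p q r : inner r (p + q) = inner r p + inner r q.
Proof. by rewrite circle_innerC circle_innerDl rmorphD /= -!circle_innerC. Qed.

Lemma circle_innerZr c p q : inner q (c *: p) = c^* * inner q p.
Proof. by rewrite circle_innerC circle_innerZl rmorphM /= -circle_innerC. Qed.

Lemma circle_inner0l q : inner 0 q = 0.
Proof. by rewrite -(scale0r (0 : {poly R[i]})) circle_innerZl mul0r. Qed.

Lemma circle_inner0r q : inner q 0 = 0.
Proof. by rewrite circle_innerC circle_inner0l rmorph0. Qed.

Lemma circle_inner_Phi n m :
  inner (Phi n) (Phi m) = (kappa n ^- 2 *+ (n == m))%:C.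
Proof.
have [_ _ _ <-] := opuc n.
apply/esym/circle_integral_weighted => t ht.
rewrite circle_weight_expi //.
have : 'i * e t != 0 by rewrite mulf_neq0 ?expi_neq0 ?neq0Ci.
by move: ('i * e t) => v v0; rewrite mulrA divfK // mulrC.
Qed.

Lemma size_sub_lead_Phi n q : (size q <= n.+1)%N ->
  (size (q - q`_n *: Phi n)%R <= n)%N.
Proof.
move=> sq; have [mon sz _ _] := opuc n.
apply/leq_sizeP => j; rewrite leq_eqVlt => /orP[/eqP <-|nj].
  have : lead_coef (Phi n) = 1 by apply/eqP; rewrite -monicE.
  by rewrite lead_coefE sz /= coefB coefZ => ->; rewrite mulr1 subrr.
rewrite coefB coefZ [q`_j]nth_default ?[(Phi n)`_j]nth_default ?sz ?mulr0 ?subrr //.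
exact: leq_trans sq nj.
Qed.

Lemma circle_inner_Phi_lt n q : (size q <= n)%N -> inner (Phi n) q = 0.
Proof.
suff H k : (k <= n)%N -> (size q <= k)%N -> inner (Phi n) q = 0.
  by move=> sq; exact: (H n).
elim: k q => [|k IH] q kn.
  by rewrite leqn0 size_poly_eq0 => /eqP ->; rewrite circle_inner0r.
move=> sq; rewrite -(subrK (q`_k *: Phi k) q) circle_innerDr circle_innerZr.
rewrite (IH _ (ltnW kn)) ?size_sub_lead_Phi // circle_inner_Phi.
by rewrite gtn_eqF // mulr0 add0r.
Qed.

(** Nondegeneracy without any positivity argument for integrals: pairing with the orthogonal
    polynomial of top degree isolates the top coefficient times [kappa ^- 2], which is nonzero, so
    the degree drops step by step. *)
Lemma circle_inner_Xn_eq0 n q : (size q <= n)%N ->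
  (forall m, (m < n)%N -> inner q 'X^m = 0) -> q = 0.
Proof.
move=> sq qX.
have qr r : (size r <= n)%N -> inner q r = 0.
  move=> sr; rewrite -(coefK r) poly_def.
  elim/big_rec: _ => [|i s _ IH]; first exact: circle_inner0r.
  by rewrite circle_innerDr circle_innerZr qX ?mulr0 ?add0r // (leq_trans _ sr).
elim: n sq {qX} qr => [|n IH] sq qr.
  by move: sq; rewrite leqn0 size_poly_eq0 => /eqP.
have [_ sz k0 _] := opuc n.
have a0 : q`_n = 0.
  have := qr (Phi n); rewrite sz => /(_ (leqnn _)).
  rewrite -{1}(subrK (q`_n *: Phi n) q) circle_innerDl circle_innerZl.
  rewrite circle_innerC circle_inner_Phi_lt ?size_sub_lead_Phi // rmorph0 add0r.
  rewrite circle_inner_Phi eqxx mulr1n => /eqP; rewrite mulf_eq0 => /orP[/eqP //|].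
  rewrite -(rmorph0 (real_complex R)) (inj_eq (@complexI R)) => /eqP h.
  by have := invr_gt0 (kappa n ^+ 2); rewrite h ltxx exprn_gt0.
apply: IH => [|r sr]; last by apply: qr; exact: leq_trans sr _.
by have := size_sub_lead_Phi sq; rewrite a0 scale0r subr0.
Qed.

(** Multiplication by [z] is an isometry on the unit circle. *)
Lemma circle_inner_mulX q m : inner ('X * q) 'X^(m.+1) = inner q 'X^m.
Proof.
apply: eq_weighted_integral => t _; rewrite !(hornerM, hornerXn, hornerX).
rewrite !rmorphXn /= exprSr expi_conj.
by move: (_ ^+ m) (expi_neq0 t) => x e0; field.
Qed.

(** The Pearson integrand for [g = z^-m q], with the factor ['i * z^-m] taken out. *)
Definition pearson_poly (m : nat) q : {poly R[i]} :=
  ((b + 1)%:P * 'X + (b^*)%:P - m%:R * ('X - 1)) * q + ('X - 1) * ('X * q^`()).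

Lemma circle_inner_pearson m q : inner (pearson_poly m q) 'X^m = 0.
Proof.
have cE (t : R) := is_derive_curve_expi t.
pose c : R -> R[i] := fun t : R => (e t)^*.
have cc : continuous_curve c by apply/continuous_curve_conj/expi_continuous.
have dc t : is_derive_curve c (fun t => - 'i * c t) t.
  have := is_derive_curve_conj (cE t); congr is_derive_curve.
  by apply/funext => u; rewrite rmorphM /= conjCi.
pose g t := q.[e t] * 'X^m.[c t].
pose g' t := 'i * ((e t * q^`().[e t]) * 'X^m.[c t] + - m%:R * (q.[e t] * 'X^m.[c t])).
have dg t : is_derive_curve g g' t.
  have := is_derive_curveM (is_derive_curve_horner q (cE t))
    (is_derive_curve_horner 'X^m (dc t)).
  congr is_derive_curve; apply/funext => u; rewrite /g' derivXn.
  (* The case [m = 0] is apart because the derivative of ['X^m] involves the truncated exponent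
     [m.-1]. *)
  case: (m) => [|k]; first by rewrite mulr0n horner0; ring.
  by rewrite hornerMn -mulr_natl !hornerXn exprS /=; ring.
have cg' : continuous_curve g'.
  have cX := continuous_curve_horner 'X^m cc.
  have cst z := @continuous_curve_cst R z.
  exact: (continuous_curveM (cst 'i) (continuous_curveD (continuous_curveM
    (continuous_curveM (expi_continuous R) (continuous_horner_expi q^`())) cX)
    (continuous_curveM (cst (- m%:R)) (continuous_curveM (continuous_horner_expi q) cX)))).
have := weighted_integral_pearson lambda_gt w_int dg cg'.
have <- : J (fun t => 'i * ((pearson_poly m q).[e t] * ('X^m.[e t])^*)) =
    J (fun t => 'i * ((b + 1) * e t + b^*) * g t + (e t - 1) * g' t).
  apply: eq_weighted_integral => t _; rewrite /g /g' /c.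
  rewrite !hornerXn rmorphXn /=; move: (_ ^+ m) => x.
  rewrite /pearson_poly -polyC_natr.
  rewrite !(hornerD, hornerN, hornerM, hornerC, hornerX).
  move: (e t) (b^* : R[i]) q.[e t] q^`().[e t] => u bb y y'; ring.
rewrite weighted_integralZ // => /eqP; rewrite mulf_eq0 => /orP[|/eqP //].
by rewrite (negbTE (neq0Ci _)).
Qed.

Theorem hypergeometric_op_Phi n :
  hypergeometric_op b n (n%:R * (1 + b)) (Phi n) = 0.
Proof.
have [_ sz _ _] := opuc n.
apply: (@circle_inner_Xn_eq0 n).
  apply/leq_sizeP => j nj; rewrite coef_hypergeometric_op.
  rewrite [(Phi n)`_j.+1]nth_default ?sz // mulr0 subr0.
  (* In degree [n] the factor [c + n (n - n - 1 - b)] vanishes for [c = n (1 + b)]: this choice of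
     constant drops the degree below [n]. *)
  move: nj; rewrite leq_eqVlt => /orP[/eqP <-|nj]; first by ring.
  by rewrite nth_default ?sz // mulr0.
move=> m mn; rewrite -circle_inner_mulX.
(* After multiplication by [z] the operator is a combination of Pearson polynomials, which are
   orthogonal to [z^(m+1)], and of multiples of [z Phi_n] and [Phi_n]. The coefficient [n - (m + 1)]
   is chosen to cancel the remaining first-derivative terms. *)
have -> : 'X * hypergeometric_op b n (n%:R * (1 + b)) (Phi n) =
    (-1) *: pearson_poly m.+1 ('X * (Phi n)^`()) +
    (n%:R - m.+1%:R) *: pearson_poly m.+1 (Phi n) +
    (n%:R * (1 + b) - (n%:R - m.+1%:R) * (b + 1 - m.+1%:R)) *: ('X * Phi n) +
    (- ((n%:R - m.+1%:R) * (b^* + m.+1%:R))) *: Phi n.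
  rewrite /hypergeometric_op /pearson_poly derivM derivX -!mul_polyC.
  rewrite !(polyCD, polyCN, polyCM, polyC1, polyC_natr).
  move: (Phi n) => p; move: (p^`()) (p^`()^`()) (n%:R : {poly R[i]}) (m.+1%:R : {poly R[i]}).
  move: (b%:P : {poly R[i]}) ((b^*)%:P : {poly R[i]}) => *; ring.
rewrite 3!circle_innerDl 4!circle_innerZl !circle_inner_pearson circle_inner_mulX.
rewrite circle_inner_Phi_lt ?size_polyXn // !mulr0 !add0r.
(* Orthogonality of [Phi_n] to [z^(m+1)] fails only for [m + 1 = n], and there its coefficient is
   zero. *)
move: mn; rewrite leq_eqVlt => /orP[/eqP ->|mn].
  by rewrite subrr mul0r oppr0 mul0r.
by rewrite circle_inner_Phi_lt ?size_polyXn // mulr0.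
Qed.

End Orthogonality.

(** * Complex derivatives from quadratic remainders *)

Lemma is_derive_quadratic_remainder (F : numFieldType) (f : F -> F^o) (z l K d : F) :
  0 < d ->
  (forall h, h != 0 -> `|h| < d -> `|f (h + z) - f z - h * l| <= K * `|h| ^+ 2) ->
  is_derive z 1 f l.
Proof.
move=> d0 hf.
suff flim : h^-1 *: ((f \o shift z) (h *: (1 : F^o)) - f z) @[h --> 0^'] --> (l : F^o).
  apply: DeriveDef; last exact: (cvg_lim _ flim).
  by apply/cvg_ex; exists l; exact: flim.
apply/cvgrPdist_le => eps eps0 /=.
(* Adding 1 keeps the divisor positive even when [K = 0]. *)
have K1 : 0 < `|K| + 1 by rewrite ltr_wpDl.
have e' : 0 < eps / (`|K| + 1) by rewrite divr_gt0.
near=> h.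
have h0 : h != 0 by near: h; exact: nbhs_dnbhs_neq.
have hd : `|h| < d by near: h; exact: dnbhs0_lt.
have hK : `|h| < eps / (`|K| + 1) by near: h; exact: dnbhs0_lt.
rewrite [h *: _]mulr1 distrC -(ler_pM2l (_ : 0 < `|h|)) ?normr_gt0 // -normrM mulrBr.
rewrite mulVKf //; have hh := hf _ h0 hd; apply: (le_trans hh).
(* [K] is not assumed real, but the bound dominates a norm, so it is nonnegative and equals its own
   norm. *)
have /normr_idP <- : 0 <= K * `|h| ^+ 2 by exact: le_trans hh.
rewrite normrM normrX normr_id expr2 mulrCA ler_wpM2l //.
rewrite (le_trans (ler_wpM2l _ (ltW hK))) // mulrCA ler_piMr ?(ltW eps0) //.
by rewrite ler_pdivrMr // mul1r lerDl.
Unshelve. all: by end_near. Qed.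

Lemma cderive_quadratic_remainder (R : realType) (f : R[i] -> R[i]) (z l K d : R[i]) :
  0 < d ->
  (forall h, h != 0 -> `|h| < d -> `|f (h + z) - f z - h * l| <= K * `|h| ^+ 2) ->
  cderivable f z /\ cderive f z = l.
Proof.
move=> d0 hf; have [df lf] := is_derive_quadratic_remainder d0 hf.
by split; [exact: df|rewrite /cderive derive1E].
Qed.

(** * Cauchy transforms of solutions *)

Section CauchyTransform.
Variables (R : realType) (lambda eta : R).
Local Notation w := (circle_density lambda eta).
Local Notation b := (lambda +i* eta : R[i]).
Local Notation mu := (@lebesgue_measure R).
Local Notation J := (weighted_integral lambda eta).
Local Notation e := (@expi R).
Hypothesis lambda_gt : - (1 / 2) < lambda.
Hypothesis w_integrable : mu.-integrable `]0, 2 * pi[ (EFin \o w).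
Variables (n : nat) (p : {poly R[i]}) (c : R[i]).
Hypothesis p_ode : hypergeometric_op b n c p = 0.

Let total := \int[mu]_(t in `]0, 2 * pi[) w t.

Lemma norm_weighted_integral_leC (f : R -> R[i]) (M : R[i]) : continuous_curve f ->
  (forall t, `|f t| <= M) -> `|J f| <= 2 * M * total%:C.
Proof.
move=> cf fM; have Mr : M \is Num.real.
  by apply: ger0_real; exact: le_trans (normr_ge0 _) (fM 0).
rewrite -(RRe_real Mr) in fM *; apply: le_trans (norm_weighted_integral_le w_integrable cf fM) _.
by rewrite !rmorphM /= rmorph_nat.
Qed.

(** The factor ['i * e t] comes from [dt] on the circle, and the conjugate power stands for [t^-n],
    which keeps the expression polynomial in [e t] and its conjugate. *)
Definition cauchy_density (t : R) : R[i] := 'i * e t * p.[e t] * (e t)^* ^+ n.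
Local Notation h := cauchy_density.

(** Up to the common constant [1 / (2 pi i)], the values at [k = 1, 2, 3] are [G], [G'] and
    [G'' / 2]. *)
Definition cauchy_kernel (k : nat) (z : R[i]) : R[i] :=
  J (fun t => h t * (e t - z)^-1 ^+ k).

Lemma cauchy_weightedE (z : R[i]) :
  cauchy_weighted (circle_weight b) n p z =
  (2 * pi%:C * 'i)^-1 * cauchy_kernel 1 z.
Proof.
congr (_ * _); apply: circle_integral_weighted => t ht.
rewrite circle_weight_expi // /h expi_conj expr1 -exprVn; ring.
Qed.

Lemma expi_sub_neq0 (z : R[i]) t : `|z| != 1 -> e t - z != 0.
Proof. by apply: contraNneq => /subr0_eq <-; rewrite norm_expi. Qed.

Lemma norm_horner_le (q : {poly R[i]}) :
  exists M, forall u : R[i], `|u| = 1 -> `|q.[u]| <= M.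
Proof.
elim/poly_ind: q => [|q k [M IH]].
  by exists 0 => u _; rewrite horner0 normr0.
exists (M + `|k|) => u u1; rewrite hornerMXaddC (le_trans (ler_normD _ _)) //.
by rewrite lerD2r normrM u1 mulr1 IH.
Qed.

Lemma continuous_kernel k (z : R[i]) : `|z| != 1 ->
  continuous_curve (fun t => h t * (e t - z)^-1 ^+ k).
Proof.
move=> z1.
have ce := expi_continuous R.
have cst x := @continuous_curve_cst R x.
have cX (f : R -> R[i]) (m : nat) : continuous_curve f -> continuous_curve (fun t => f t ^+ m).
  move=> cf; have := continuous_curve_horner 'X^m cf.
  by congr continuous_curve; apply/funext => t; rewrite hornerXn.
have ch := continuous_curveM (continuous_curveM (continuous_curveM (cst 'i) ce)
  (continuous_curve_horner p ce)) (cX _ n (continuous_curve_conj ce)).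
apply: (continuous_curveM ch).
apply: cX; apply: is_derive_curve_continuous => t.
apply: is_derive_curveV; first exact: expi_sub_neq0.
exact: (is_derive_curveD (is_derive_curve_expi t) (is_derive_curve_cst (- z) t)).
Qed.

(** The distance from [z] to the unit circle. *)
Let dist (z : R[i]) : R[i] := `| `|z| - 1|.

Lemma norm_expi_sub_ge (z : R[i]) t : dist z <= `|e t - z|.
Proof.
by rewrite /dist -(norm_expi t) distrC ler_dist_dist.
Qed.

Lemma dist_circle_gt0 (z : R[i]) : `|z| != 1 -> 0 < dist z.
Proof. by move=> z1; rewrite normr_gt0 subr_eq0. Qed.

Lemma dist_circle_half (z y : R[i]) : `|y| < dist z / 2 ->
  dist z / 2 <= dist (y + z).
Proof.
move=> yd.
have dz : dist z <= dist z / 2 + dist (y + z).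
  apply: (le_trans (ler_distD `|y + z| `|z| 1)); rewrite lerD2r.
  apply: le_trans (ltW yd); apply: (le_trans (ler_dist_dist _ _)).
  by rewrite opprD addrCA subrr addr0 normrN.
rewrite -(lerD2l (dist z / 2)); apply: le_trans dz.
by rewrite -splitr.
Qed.

Lemma off_circle_near (z y : R[i]) : `|z| != 1 -> `|y| < dist z / 2 ->
  `|y + z| != 1.
Proof.
move=> z1 /dist_circle_half; have d0 := dist_circle_gt0 z1.
apply: contraTneq => yz1; rewrite /dist yz1 subrr normr0 -/(dist z).
by rewrite lt_geF // divr_gt0.
Qed.

Lemma norm_inv_le (D x : R[i]) : 0 < D -> D <= `|x| -> `|x^-1| <= D^-1.
Proof.
move=> D0 Dx; rewrite normfV lef_pV2 // posrE //.
exact: lt_le_trans Dx.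
Qed.

Lemma inv_power_remainder1 (D y B : R[i]) : 0 < D -> D <= `|B| -> D <= `|B - y| ->
  `|(B - y)^-1 ^+ 1 - B^-1 ^+ 1 - y * (1 * B^-1 ^+ 2)| <= D^-1 ^+ 3 * `|y| ^+ 2.
Proof.
move=> D0 DB DA.
have B0 : B != 0 by rewrite -normr_gt0 (lt_le_trans D0).
have A0 : B - y != 0 by rewrite -normr_gt0 (lt_le_trans D0).
have -> : (B - y)^-1 ^+ 1 - B^-1 ^+ 1 - y * (1 * B^-1 ^+ 2) =
    (B - y)^-1 * B^-1 ^+ 2 * y ^+ 2 by field; rewrite A0 B0.
rewrite normrM [`|y ^+ 2|]normrX ler_wpM2r ?exprn_ge0 // normrM normrX [D^-1 ^+ 3]exprS.
have iA := norm_inv_le D0 DA; have iB := norm_inv_le D0 DB.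
by apply: ler_pM => //; rewrite ?exprn_ge0 // lerXn2r // nnegrE (le_trans (normr_ge0 _) iB).
Qed.

(** The exact Taylor remainder is [(B - y)^-2 B^-2 (3 - 2 y / B) y^2]; as [|y / B| <= 1], the middle
    factor has norm at most [5 = 3 + 2]. *)
Lemma inv_power_remainder2 (D y B : R[i]) : 0 < D -> `|y| <= D ->
  D <= `|B| -> D <= `|B - y| ->
  `|(B - y)^-1 ^+ 2 - B^-1 ^+ 2 - y * (2 * B^-1 ^+ 3)| <=
  5 * D^-1 ^+ 4 * `|y| ^+ 2.
Proof.
move=> D0 yD DB DA.
have B0 : B != 0 by rewrite -normr_gt0 (lt_le_trans D0).
have A0 : B - y != 0 by rewrite -normr_gt0 (lt_le_trans D0).
have -> : (B - y)^-1 ^+ 2 - B^-1 ^+ 2 - y * (2 * B^-1 ^+ 3) =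
    (B - y)^-1 ^+ 2 * B^-1 ^+ 2 * (3 - 2 * (y * B^-1)) * y ^+ 2.
  by field; rewrite A0 B0.
rewrite normrM [`|y ^+ 2|]normrX ler_wpM2r ?exprn_ge0 // normrM [leRHS]mulrC.
have iA := norm_inv_le D0 DA; have iB := norm_inv_le D0 DB.
have iD : 0 <= D^-1 by rewrite invr_ge0 ltW.
apply: ler_pM => //.
  rewrite normrM !normrX (_ : D^-1 ^+ 4 = D^-1 ^+ 2 * D^-1 ^+ 2); last by rewrite -exprD.
  by apply: ler_pM; rewrite ?exprn_ge0 // lerXn2r.
rewrite (le_trans (ler_normB _ _)) // normrM !normr_nat (_ : 5 = 3 + 2 * 1); last by ring.
rewrite lerD2l ler_wpM2l // normrM -(mulfV (lt0r_neq0 D0)).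
by apply: ler_pM.
Qed.

(** Differentiation under the integral sign by an explicit estimate: for [y] within half the
    distance to the circle, both denominators stay above that half, so the pointwise remainder is
    uniform in [t] and can be integrated. *)
Lemma cauchy_kernel_remainder (k : nat) (z : R[i]) : `|z| != 1 ->
  (k == 1)%N || (k == 2)%N ->
  exists K, forall y, `|y| < dist z / 2 ->
    `|cauchy_kernel k (y + z) - cauchy_kernel k z - y * (k%:R * cauchy_kernel k.+1 z)|
    <= K * `|y| ^+ 2.
Proof.
move=> z1 k12; have d0 := dist_circle_gt0 z1.
have D0 : 0 < dist z / 2 by rewrite divr_gt0.
have [M hM] := norm_horner_le p.
have [C hC] : exists C, forall y t, `|y| < dist z / 2 ->
    `|(e t - (y + z))^-1 ^+ k - (e t - z)^-1 ^+ k - y * (k%:R * (e t - z)^-1 ^+ k.+1)|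
    <= C * `|y| ^+ 2.
  have hB t : dist z / 2 <= `|e t - z|.
    by apply: le_trans (norm_expi_sub_ge z t); rewrite ler_pdivrMr // ler_peMr ?ler1n // ltW.
  have hA t y : `|y| < dist z / 2 -> dist z / 2 <= `|e t - z - y|.
    move=> yd; apply: (le_trans (dist_circle_half yd)).
    by rewrite (_ : _ - y = e t - (y + z)) ?norm_expi_sub_ge //; ring.
  case/orP: k12 => /eqP ->.
    exists ((dist z / 2)^-1 ^+ 3) => y t yd.
    rewrite (_ : e t - (y + z) = e t - z - y); last by ring.
    by apply: inv_power_remainder1 => //; exact: hA.
  exists (5 * (dist z / 2)^-1 ^+ 4) => y t yd.
  rewrite (_ : e t - (y + z) = e t - z - y); last by ring.
  by apply: inv_power_remainder2 => //; [exact: ltW|exact: hA].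
(* [M] bounds [p] on the circle, [C] the pointwise remainder, and [2 * total] is the cost of
   integrating. *)
exists (2 * (M * C) * total%:C) => y yd.
have yz1 := off_circle_near z1 yd.
have c1 := continuous_kernel k yz1.
have c2 := continuous_kernel k z1.
have c3 := continuous_kernel k.+1 z1.
have cst x := @continuous_curve_cst R x.
have c2' := continuous_curveM (cst (-1)) c2.
have c3' := continuous_curveM (cst (- (y * k%:R))) c3.
have -> : cauchy_kernel k (y + z) - cauchy_kernel k z -
      y * (k%:R * cauchy_kernel k.+1 z) =
    J (fun t => h t * (e t - (y + z))^-1 ^+ k + (-1 * (h t * (e t - z)^-1 ^+ k) +
      - (y * k%:R) * (h t * (e t - z)^-1 ^+ k.+1))).
  rewrite !(weighted_integralD, weighted_integralZ) //; last exact: continuous_curveD.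
  have key (a1 a2 a3 u v : R[i]) :
    a1 - a2 - u * (v * a3) = a1 + (-1 * a2 + - (u * v) * a3) by ring.
  exact: key.
have M0 : 0 <= M by apply: le_trans (hM _ (norm_expi 0)).
rewrite [leRHS](_ : _ = 2 * (M * (C * `|y| ^+ 2)) * total%:C); last by ring.
apply: norm_weighted_integral_leC.
  by apply: continuous_curveD => //; exact: continuous_curveD.
move=> t; rewrite [X in `|X|](_ : _ = h t * ((e t - (y + z))^-1 ^+ k -
  (e t - z)^-1 ^+ k - y * (k%:R * (e t - z)^-1 ^+ k.+1))); last by ring.
rewrite normrM; apply: ler_pM => //; last exact: hC.
rewrite /h !normrM normCi normrX norm_conjC norm_expi expr1n !mul1r mulr1.
by apply: hM; exact: norm_expi.
Qed.

Local Notation G := (cauchy_weighted (circle_weight b) n p).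
Local Notation c0 := ((2 * pi%:C * 'i)^-1 : R[i]).

(** Agreement of [f] with the kernel is asked off the circle only, so the statement also applies to
    [f = cderive G], whose formula is known only there. *)
Lemma cderive_cauchy_kernel (f : R[i] -> R[i]) (a : R[i]) (k : nat) (z : R[i]) :
  `|z| != 1 -> (k == 1)%N || (k == 2)%N ->
  (forall x, `|x| != 1 -> f x = a * cauchy_kernel k x) ->
  cderivable f z /\ cderive f z = a * k%:R * cauchy_kernel k.+1 z.
Proof.
move=> z1 k12 fE; have d0 := dist_circle_gt0 z1.
have [K hK] := cauchy_kernel_remainder z1 k12.
apply: (@cderive_quadratic_remainder _ _ _ _ (`|a| * K) (dist z / 2)).
  by rewrite divr_gt0.
move=> y _ yd; rewrite !fE ?off_circle_near //.
have -> : forall a1 a2 a3 v : R[i], a * a1 - a * a2 - y * (a * v * a3) =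
  a * (a1 - a2 - y * (v * a3)) by move=> *; ring.
by rewrite normrM -mulrA ler_wpM2l // hK.
Qed.

Lemma cauchy_weighted_cderive (z : R[i]) : `|z| != 1 ->
  cderivable G z /\ cderive G z = c0 * cauchy_kernel 2 z.
Proof.
move=> z1; rewrite -[c0]mulr1.
by apply: (@cderive_cauchy_kernel G c0 1) => // x _; exact: cauchy_weightedE.
Qed.

Lemma cauchy_weighted_cderive2 (z : R[i]) : `|z| != 1 ->
  cderivable (cderive G) z /\
  cderive (cderive G) z = c0 * 2 * cauchy_kernel 3 z.
Proof.
move=> z1; apply: (@cderive_cauchy_kernel (cderive G) c0 2) => // x x1.
by have [_ ->] := cauchy_weighted_cderive x1.
Qed.

(* The Pearson field [u^(1-n) (p'(u) r + p(u) r^2)], [r = 1 / (u - z)], is the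
   bilinear concomitant of the equation for [p] and the kernel [r]; the boundary
   terms of order [nu] cancel in it. *)
Lemma cauchy_kernel_relation (z : R[i]) : `|z| != 1 ->
  z * (1 - z) * (2 * cauchy_kernel 3 z) +
  ((b - n%:R - 2) * z + (1 + n%:R + b^*)) * cauchy_kernel 2 z +
  (c + b - n%:R) * cauchy_kernel 1 z = 0.
Proof.
move=> z1.
have cst x := @continuous_curve_cst R x.
pose r t := (e t - z)^-1.
pose ebar t : R[i] := (e t)^*.
have dcst x t := @is_derive_curve_cst R x t.
have dE t := @is_derive_curve_expi R t.
have dr t : is_derive_curve r (fun t => - (('i * e t + 0) / (e t - z) ^+ 2)) t.
  apply: is_derive_curveV; first exact: expi_sub_neq0.
  exact: (is_derive_curveD (dE t) (dcst (- z) t)).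
have debar t : is_derive_curve ebar (fun t => ('i * e t)^*) t.
  exact: is_derive_curve_conj (dE t).
have cr : continuous_curve r by exact: is_derive_curve_continuous dr.
have ce := expi_continuous R.
have cebar := continuous_curve_conj ce.
pose E t := e t * ebar t ^+ n.
pose g t := E t * (p^`().[e t] * r t + p.[e t] * (r t * r t)).
pose g' t := 'i * (E t * ((1 - n%:R) * (p^`().[e t] * r t + p.[e t] * (r t * r t)) +
  e t * (p^`()^`().[e t] * r t + -2 * (p.[e t] * (r t * (r t * r t)))))).
have dg t : is_derive_curve g g' t.
  have := is_derive_curveM (is_derive_curveM (dE t)
      (is_derive_curve_horner 'X^n (debar t)))
    (is_derive_curveD (is_derive_curveM (is_derive_curve_horner p^`() (dE t)) (dr t))
      (is_derive_curveM (is_derive_curve_horner p (dE t)) (is_derive_curveM (dr t) (dr t)))).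
  congr is_derive_curve; apply/funext => u; rewrite /g /g' /E hornerXn //.
  have -> : ('X^n)^`().[ebar u] * ('i * e u)^* = - 'i * n%:R * ebar u ^+ n.
    rewrite derivXn rmorphM /= conjCi -/(ebar u).
    case: (n) => [|k]; first by rewrite mulr0n horner0 mulr0 !mul0r.
    by rewrite hornerMn -mulr_natl !hornerXn exprS /=; ring.
  rewrite addr0 -exprVn -/(r u).
  move: (ebar u ^+ n) (r u) (e u) (p.[e u]) (p^`().[e u]) (p^`()^`().[e u]).
  move=> x1 x2 x3 x4 x5 x6; ring.
have cg' : continuous_curve g'.
  have cp q := continuous_curve_horner q ce.
  have cXn : continuous_curve (fun t => ebar t ^+ n).
    have := continuous_curve_horner 'X^n cebar.
    by congr continuous_curve; apply/funext => t; rewrite hornerXn.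
  have crr := continuous_curveM cr cr.
  have cE := continuous_curveM ce cXn.
  exact: (continuous_curveM (cst 'i) (continuous_curveM cE (continuous_curveD
    (continuous_curveM (cst (1 - n%:R)) (continuous_curveD
      (continuous_curveM (cp p^`()) cr) (continuous_curveM (cp p) crr)))
    (continuous_curveM ce (continuous_curveD (continuous_curveM (cp p^`()^`()) cr)
      (continuous_curveM (cst (-2)) (continuous_curveM (cp p)
        (continuous_curveM cr crr)))))))).
rewrite -(weighted_integral_pearson lambda_gt w_integrable dg cg').
have c1 := continuous_kernel 1 z1.
have c2 := continuous_kernel 2 z1.
have c3 := continuous_kernel 3 z1.
pose z3 := z * (1 - z) * 2.
pose z2 := (b - n%:R - 2) * z + (1 + n%:R + b^*).
pose z0 := c + b - n%:R.
have c1' := continuous_curveM (cst z0) c1.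
have c2' := continuous_curveM (cst z2) c2.
have c3' := continuous_curveM (cst z3) c3.
transitivity (J (fun t => (z3 * (h t * (e t - z)^-1 ^+ 3) +
    z2 * (h t * (e t - z)^-1 ^+ 2)) + z0 * (h t * (e t - z)^-1 ^+ 1))).
  rewrite weighted_integralD //; last exact: continuous_curveD.
  rewrite weighted_integralD // !weighted_integralZ //.
  by congr (_ + _ + _); rewrite /z3 mulrA.
apply: eq_weighted_integral => t _; rewrite /g' /g /E /h -/(ebar t).
have s0 := expi_sub_neq0 t z1.
have := congr1 (fun q : {poly R[i]} => q.[e t]) p_ode.
rewrite /= horner_hypergeometric_op horner0.
rewrite /z3 /z2 /z0 /r -[(p^`(2))]/(p^`()^`()).
move: (e t) s0 => u s0.
move: (p.[u]) (p^`().[u]) (p^`()^`().[u]) (ebar t ^+ n) => P P1 P2 x.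
move: (n%:R : R[i]) b c ('i : R[i]) => N B C I; set Bb := _^*.
move: Bb => Bb ode.
(* The second derivative occurs only through [(u - 1) u p'']. Once the equation replaces it, all
   [p'] terms cancel; expanding the coefficients of [p] around [u = z] leaves the three kernels. *)
have odeE : (u - 1) * (u * P2) = ((N - B - 2) * u + (1 - N - Bb)) * P1 + C * P.
  by apply/eqP; rewrite -subr_eq0 -[X in _ == X]oppr0 -ode; apply/eqP; ring.
transitivity (I * u * x * (
  ((B + 1) * u + Bb + (u - 1) * (1 - N)) * (P1 / (u - z) + P / (u - z) ^+ 2) +
  (u - 1) * (u * P2) / (u - z) + 2 * (1 - u) * u * P / (u - z) ^+ 3)); last by field.
by rewrite odeE; field.
Qed.

(** The constant [c] is left general: [c = n (1 + b)] turns [c + b - n] into [b (1 + n)], and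
    [c = b (n - 1)] turns it into [n (b - 1)]. *)
Theorem cauchy_weighted_hypergeometric (z : R[i]) : `|z| != 1 ->
  [/\ cderivable G z, cderivable (cderive G) z &
    z * (1 - z) * cderive (cderive G) z +
    ((b - n%:R - 2) * z + (1 + n%:R + b^*)) * cderive G z +
    (c + b - n%:R) * G z = 0].
Proof.
move=> z1; have [d1 e1] := cauchy_weighted_cderive z1.
have [d2 e2] := cauchy_weighted_cderive2 z1; split=> //.
rewrite e2 e1 cauchy_weightedE.
rewrite -[RHS](mulr0 c0) -(cauchy_kernel_relation z1).
move: (cauchy_kernel 1 z) (cauchy_kernel 2 z) (cauchy_kernel 3 z) c0.
by move: (n%:R : R[i]) (b^* : R[i]) b => *; ring.
Qed.

End CauchyTransform.

(** * Assembly of the four equations *)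

Theorem mainTheorem12 (R : realType) (lambda eta : R)
    (Phi : nat -> {poly R[i]}) (kappa : nat -> R) :
  - (1 / 2) < lambda ->
  let b : R[i] := lambda +i* eta in
  let nu : R[i] -> R[i] := circle_weight b in
  monic_opuc nu Phi kappa ->
  forall n : nat, (0 < n)%N ->
  let Phis : {poly R[i]} := conj_rev n.-1 (Phi n.-1) in
  let G : R[i] -> R[i] := cauchy_weighted nu n (Phi n) in
  let Gs : R[i] -> R[i] := cauchy_weighted nu n Phis in
  [/\ forall z : R[i],
        z * (1 - z) * ((Phi n)^`(2)%R).[z]
        + ((n%:R - b - 2) * z + (1 - n%:R - b^*)) * ((Phi n)^`()%R).[z]
        + n%:R * (1 + b) * (Phi n).[z] = 0,
      forall z : R[i], `|z| != 1 ->
        [/\ cderivable G z, cderivable (cderive G) z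
          & z * (1 - z) * cderive (cderive G) z
            + ((b - n%:R - 2) * z + (1 + n%:R + b^*)) * cderive G z
            + b * (1 + n%:R) * G z = 0],
      forall z : R[i],
        z * (1 - z) * (Phis^`(2)%R).[z]
        + ((n%:R - b - 2) * z + (1 - n%:R - b^*)) * (Phis^`()%R).[z]
        + b * (n%:R - 1) * Phis.[z] = 0
    & forall z : R[i], `|z| != 1 ->
        [/\ cderivable Gs z, cderivable (cderive Gs) z
          & z * (1 - z) * cderive (cderive Gs) z
            + ((b - n%:R - 2) * z + (1 + n%:R + b^*)) * cderive Gs z
            + n%:R * (b - 1) * Gs z = 0]].
Proof.
move=> lambda_gt b nu opuc n n0 Phis G Gs.
have w_int := circle_density_integrable opuc.
have odePhi : hypergeometric_op b n (n%:R * (1 + b)) (Phi n) = 0.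
  exact: hypergeometric_op_Phi lambda_gt opuc n.
have odePhis : hypergeometric_op b n (b * (n%:R - 1)) Phis = 0.
  (* The reversal is applied at [N = n - 1], whose raised index is [n] because [n > 0]. *)
  have -> : (n%:R - 1 : R[i]) = n.-1%:R by rewrite -subn1 natrB.
  have [_ sz _ _] := opuc n.-1.
  have := hypergeometric_op_conj_rev (eq_leq sz)
    (hypergeometric_op_Phi lambda_gt opuc n.-1).
  by rewrite prednK.
have constE1 (x y : R[i]) : y * (1 + x) = x * (1 + y) + y - x by ring.
have constE2 (x y : R[i]) : x * (y - 1) = y * (x - 1) + y - x by ring.
split.
- by move=> z; rewrite -horner_hypergeometric_op odePhi horner0.
- move=> z z1.
  have [d1 d2 e] := cauchy_weighted_hypergeometric lambda_gt w_int odePhi z1.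
  split; [exact: d1|exact: d2|].
  by rewrite (_ : b * (1 + n%:R) = n%:R * (1 + b) + b - n%:R); [exact: e|exact: constE1].
- by move=> z; rewrite -horner_hypergeometric_op odePhis horner0.
- move=> z z1.
  have [d1 d2 e] := cauchy_weighted_hypergeometric lambda_gt w_int odePhis z1.
  split; [exact: d1|exact: d2|].
  by rewrite (_ : n%:R * (b - 1) = b * (n%:R - 1) + b - n%:R); [exact: e|exact: constE2].
Qed.
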